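(* Let $P$ be a convex polygon which is not a parallelogram. Then the maximum number of (inclusion-wise) maximal cliques in an $n$-vertex graph in $P_{hom}$ is $\Omega(n^3)$ (as $n\to\infty$, with $P$ fixed).
   Context: All graphs are finite. A polygon is a closed convex polygon in $\mathbb{R}^2$. For a finite collection of sets, its intersection graph has one vertex for each member of the collection, and two distinct vertices are adjacent iff the corresponding sets have nonempty intersection. $P_{hom}$ is the class of intersection graphs of finite collections of sets homothetic to $P$, i.e. sets obtained from $P$ by (positive) scaling and/or translation. *)

(* Defs.v *)
From HB Require Import structures.
From mathcomp Require Import all_boot all_order all_algebra.
From mathcomp Require Import all_classical all_reals all_analysis.

Set Implicit Arguments.
Unset Strict Implicit.
Unset Printing Implicit Defensive.

Import Order.TTheory GRing.Theory Num.Theory.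
Import numFieldNormedType.Exports.

Local Open Scope classical_set_scope.
Local Open Scope ring_scope.

Definition convex_hull (R : realType) (s : seq 'rV[R]_2) : set 'rV[R]_2 :=
  smallest (@convex_set R 'rV[R]_2) [set` s].

(* The nonempty interior excludes the empty set, points and segments. *)
Definition is_polygon (R : realType) (P : set 'rV[R]_2) : Prop :=
  (exists s : seq 'rV[R]_2, P = convex_hull s) /\ P° !=set0.

Definition is_parallelogram (R : realType) (P : set 'rV[R]_2) : Prop :=
  exists a u v : 'rV[R]_2,
    free [:: u; v] /\ P = convex_hull [:: a; a + u; a + v; a + u + v].

Definition homothetic (R : realType) (P Q : set 'rV[R]_2) : Prop :=
  exists (c : R) (v : 'rV[R]_2), 0 < c /\ Q = [set c *: x + v | x in P].

(* A simple graph on 'I_n is represented by its adjacency matrix. *)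
Definition is_intersection_graph (T : Type) (n : nat) (F : 'I_n -> set T)
    (G : 'M[bool]_n) : Prop :=
  forall i j : 'I_n, G i j <-> i != j /\ F i `&` F j !=set0.

(* F enumerates the collection; it is injective because the members of a
   collection of sets are pairwise distinct. *)
Definition in_Phom (R : realType) (P : set 'rV[R]_2) (n : nat)
    (G : 'M[bool]_n) : Prop :=
  exists F : 'I_n -> set 'rV[R]_2,
    [/\ injective F, forall i, homothetic P (F i) & is_intersection_graph F G].

Definition clique (n : nat) (G : 'M[bool]_n) (K : {set 'I_n}) : bool :=
  [forall i in K, forall j in K, (i != j) ==> G i j].

Definition num_maximal_cliques (n : nat) (G : 'M[bool]_n) : nat :=
  #|[set K : {set 'I_n} | maxset (clique G) K]|.

Definition max_num_maximal_cliques (R : realType) (P : set 'rV[R]_2)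
    (n : nat) : nat :=
  \max_(G : 'M[bool]_n | `[< in_Phom P G >]) num_maximal_cliques G.

(* Main.v *)
(** Two translates P + p and P + q meet iff p - q lies in the symmetric polygon
    D = P - P.  Write D as an intersection of as few strips |f_k| <= 1 as
    possible.  By minimality there are points z_k with f_k(z_k) = 1 and
    |f_j(z_k)| < 1 for j <> k: a point in the relative interior of each pair of
    opposite edges.  Two strips would make P a parallelogram, so there are three
    such points.  Translating P by c z_i with c close to 1/2 or to -1/2 gives, in
    each direction i, translates whose graph is the complement of a half graph,
    with linearly many maximal cliques; translates in different directions
    always meet, as (z_i +- z_j)/2 is interior to D.  Choosing one maximal clique
    per direction independently gives cubically many maximal cliques. *)

Require Import Defs.
From mathcomp Require Import all_boot all_order all_algebra.
From mathcomp Require Import all_classical all_reals all_analysis.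
From mathcomp Require Import zify ring lra.
Set Implicit Arguments.
Unset Strict Implicit.
Unset Printing Implicit Defensive.

Import Order.TTheory GRing.Theory Num.Theory.
Import numFieldNormedType.Exports.
Local Open Scope classical_set_scope.
Local Open Scope ring_scope.

(** * Convex hulls of finite sets as polyhedra *)

Section Convex.
Context {R : realType} {n : nat}.
Local Notation V := 'rV[R]_n.
Implicit Types (x y : V) (A C : set V) (s : seq V) (f : 'cV[R]_n).

Lemma convex_rowP A : convex_set (A : set (convex_lmodType V)) <->
  forall x y (t : R), 0 <= t <= 1 -> A x -> A y -> A (t *: x + (1 - t) *: y).
Proof.
split=> [cA x y t t01 Ax Ay|cA x y t /set_mem Ax /set_mem Ay]; last first.
  by apply/mem_set/cA => //; rewrite ge0 le1.
have /andP[t0 t1] := t01.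
have itv : Itv.spec (@Itv.num_sem R) (Itv.Real `[0%Z, 1%Z]) t.
  by rewrite /Itv.num_sem /Itv.spec /= in_itv /= t0 t1 ger0_real.
by have /set_mem := cA x y (Itv.mk itv) (mem_set Ax) (mem_set Ay).
Qed.

(** Peeling off one generator per recursive call matches the elimination in [cone_polyhedral]. *)
Fixpoint cone s : set V :=
  if s is a :: s' then [set x | exists2 t : R, 0 <= t & cone s' (x - t *: a)]
  else [set 0].

Definition ev x f : R := (x *m f) 0 0.

Lemma evDl x y f : ev (x + y) f = ev x f + ev y f.
Proof. by rewrite /ev mulmxDl mxE. Qed.

Lemma evZl t x f : ev (t *: x) f = t * ev x f.
Proof. by rewrite /ev -scalemxAl mxE. Qed.

Lemma evNl x f : ev (- x) f = - ev x f.
Proof. by rewrite /ev mulNmx mxE. Qed.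

Lemma evBl x y f : ev (x - y) f = ev x f - ev y f.
Proof. by rewrite evDl evNl. Qed.

Lemma evZr t x f : ev x (t *: f) = t * ev x f.
Proof. by rewrite /ev -scalemxAr mxE. Qed.

Lemma evBr x f g : ev x (f - g) = ev x f - ev x g.
Proof. by rewrite /ev mulmxBr !mxE. Qed.

(** The extra 0 covers the empty list and keeps the maximum nonnegative, as a cone coefficient must
    be. *)
Lemma seq_max (l : seq R) :
  exists2 t : R, t \in 0 :: l & {in 0 :: l, forall z : R, z <= t}.
Proof.
elim: l => [|a l [t tl ub]].
  by exists 0 => [|y]; rewrite ?mem_head// inE => /eqP ->.
exists (Num.max a t).
  rewrite /Order.max; case: ifP => _; last by rewrite !inE eqxx orbT.
  by move: tl; rewrite !inE => /orP[->//|->]; rewrite !orbT.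
move=> y; rewrite !inE le_max => /or3P[/eqP->|/eqP->|yl].
- by rewrite (ub 0) ?mem_head ?orbT.
- by rewrite lexx.
- by rewrite (ub y) ?orbT// inE yl orbT.
Qed.

(* Fourier-Motzkin elimination of the coefficient of the first generator. *)
Lemma cone_polyhedral s :
  exists L : seq 'cV[R]_n, forall x, cone s x <-> {in L, forall f, 0 <= ev x f}.
Proof.
elim: s => [|a s [L LP]].
  exists ([seq delta_mx i 0 | i : 'I_n] ++ [seq - delta_mx i 0 | i : 'I_n]) => x.
  have evd i : ev x (delta_mx i 0) = x 0 i by rewrite /ev -colE mxE.
  split=> [-> f _|x0]; first by rewrite /ev mul0mx mxE.
  apply/rowP => i; rewrite mxE; apply: le_anti; apply/andP; split.
    rewrite -oppr_ge0 -evd -[leRHS]/(- (x *m delta_mx i 0) 0 0).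
    have := x0 (- delta_mx i 0); rewrite /ev mulmxN mxE; apply.
    rewrite mem_cat; apply/orP; right; apply/mapP.
    by exists i; rewrite ?mem_enum.
  rewrite -evd; apply: x0; rewrite mem_cat; apply/orP; left; apply/mapP.
  by exists i; rewrite ?mem_enum.
(* The members of [L1] vanish at [a]: each is a positive combination of a functional positive at [a]
   and one negative there. *)
pose L0 := [seq f <- L | 0 <= ev a f].
pose L1 := [seq ev a f *: g - ev a g *: f |
             f <- [seq f <- L | 0 < ev a f], g <- [seq g <- L | ev a g < 0]].
exists (L0 ++ L1) => x; split=> [[t t0 /LP xt] h|xL].
  have fxt f : f \in L -> t * ev a f <= ev x f.
    by move=> /xt; rewrite evBl evZl subr_ge0.
  rewrite mem_cat => /orP[|/allpairsP[[f g] /= []]].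
    rewrite mem_filter => /andP[fa fL].
    by apply: le_trans (fxt _ fL); rewrite mulr_ge0.
  rewrite !mem_filter => /andP[fa fL] /andP[ga gL] ->.
  rewrite evBr !evZr; have := fxt _ fL; have := fxt _ gL.
  by move=> h1 h2; nra.
(* Functionals negative at [a] bound the coefficient of [a] from below; [t] is the least admissible
   value. The upper bounds, from functionals positive at [a], then hold by [L0] if [t] is 0 and by
   [L1] otherwise. *)
have [t tmem tub] := seq_max [seq ev x g / ev a g | g <- [seq g <- L | ev a g < 0]].
have t0 : 0 <= t by rewrite tub ?mem_head.
exists t => //; apply/LP => f fL; rewrite evBl evZl subr_ge0.
case: (ltgtP (ev a f) 0) => [fa|fa|fa].
- rewrite -ler_ndivrMr// tub// inE; apply/orP; right; apply/mapP; exists f => //.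
  by rewrite mem_filter fa.
- have fx : 0 <= ev x f by apply: xL; rewrite mem_cat mem_filter (ltW fa) fL.
  move: tmem; rewrite inE => /orP[/eqP->|]; first by rewrite mul0r.
  move=> /mapP[g]; rewrite mem_filter => /andP[ga gL] ->.
  have : 0 <= ev x (ev a f *: g - ev a g *: f).
    apply: xL; rewrite mem_cat; apply/orP; right; apply/allpairsP; exists (f, g).
    by rewrite !mem_filter fa fL ga gL.
  rewrite evBr !evZr => h; rewrite mulrAC ler_ndivrMr//; lra.
- rewrite fa mulr0; apply: xL; rewrite mem_cat mem_filter fa lexx fL//.
Qed.

Lemma coneD s x y : cone s x -> cone s y -> cone s (x + y).
Proof.
elim: s x y => [|a s IH] x y /=; first by move=> -> ->; rewrite addr0.
move=> [t t0 xt] [u u0 yu]; exists (t + u); rewrite ?addr_ge0//.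
by rewrite scalerDl opprD addrACA; exact: IH.
Qed.

Lemma coneZ s (c : R) x : 0 <= c -> cone s x -> cone s (c *: x).
Proof.
move=> c0; elim: s x => [|a s IH] x /=; first by move=> ->; rewrite scaler0.
move=> [t t0 xt]; exists (c * t); rewrite ?mulr_ge0//.
by rewrite -scalerA -scalerBr; exact: IH.
Qed.

Lemma cone0 s : cone s 0.
Proof. by elim: s => //= a s IH; exists 0; rewrite // scale0r subr0. Qed.

Lemma cone_mem s x : x \in s -> cone s x.
Proof.
elim: s => //= a s IH; rewrite inE => /orP[/eqP->|xs].
  by exists 1; rewrite // scale1r subrr; exact: cone0.
by exists 0; rewrite // scale0r subr0; exact: IH.
Qed.

End Convex.

Section Hull.
Context {R : realType}.
Local Notation V := 'rV[R]_2.
Implicit Types (x y : V) (A C : set V) (s : seq V).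

Lemma convex_hull_conv s x y t : 0 <= t <= 1 ->
  convex_hull s x -> convex_hull s y -> convex_hull s (t *: x + (1 - t) *: y).
Proof.
move=> t01 hx hy C [cC sC]; have /convex_rowP cC' := cC.
by apply: cC' => //; [exact: hx|exact: hy].
Qed.

Lemma mem_convex_hull s x : x \in s -> convex_hull s x.
Proof. by move=> xs; exact: sub_gen_smallest. Qed.

Lemma convex_hull_sub s C :
  (forall x y (t : R), 0 <= t <= 1 -> C x -> C y -> C (t *: x + (1 - t) *: y)) ->
  {in s, forall x, C x} -> convex_hull s `<=` C.
Proof. by move=> /convex_rowP cC sC; apply: smallest_sub => // x /= /sC. Qed.

Definition homog x : 'rV[R]_(2 + 1) := row_mx x 1.

(** The last coordinate of a conic combination is the sum of its coefficients, so at height 1 the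
    combination is convex. *)
Lemma convex_hull_coneP s x :
  convex_hull s x <-> cone [seq homog y | y <- s] (homog x).
Proof.
split.
  apply: (@convex_hull_sub s [set x | cone [seq homog y | y <- s] (homog x)]).
    move=> {}x y t /andP[t0 t1] /= hx hy.
    suff -> : homog (t *: x + (1 - t) *: y) = t *: homog x + (1 - t) *: homog y.
      by apply: coneD; apply: coneZ => //; rewrite subr_ge0.
    rewrite /homog !scale_row_mx add_row_mx -scalerDl [t + _]addrC subrK.
    by rewrite scale1r.
  by move=> y ys /=; apply: cone_mem; exact: map_f.
(* The induction needs an arbitrary height [u]. At height 0 the vector is 0 and no hull point is
   required, which covers the empty list. *)
move=> cx; suff H s' y (u : R) : {subset s' <= s} ->
    cone [seq homog y | y <- s'] (row_mx y u%:M) ->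
    0 <= u /\ exists2 z, (convex_hull s z \/ u = 0) & y = u *: z.
  have := @H s x 1 (fun _ h => h) cx.
  by move=> [_ [z [//|/eqP]]]; rewrite ?oner_eq0// scale1r => + ->.
elim: s' y u {cx} => [|a s' IH] y u sub /=.
  move=> /eqP; rewrite row_mx_eq0 => /andP[/eqP-> /eqP/matrixP/(_ 0 0)].
  rewrite !mxE eqxx mulr1n => ->; split=> //.
  by exists 0; [right|rewrite scaler0].
move=> [t t0]; rewrite /homog scale_row_mx opp_row_mx add_row_mx.
rewrite -[1 in X in row_mx _ X]/(1%:M : 'M[R]_1) scale_scalar_mx mulr1.
have -> : u%:M - t%:M = (u - t)%:M :> 'M[R]_1 by rewrite raddfB.
have sub' : {subset s' <= s} by move=> b bs; apply: sub; rewrite inE bs orbT.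
have as_ : convex_hull s a by apply: mem_convex_hull; apply: sub; rewrite mem_head.
move=> /(IH _ _ sub')[ut0 [z hz]] /eqP; rewrite subr_eq => /eqP ->.
split; first lra.
have [u0|u0] := eqVneq u 0.
  have -> : t = 0 by lra.
  by exists 0; [right|rewrite u0 subrr !scale0r addr0].
have ugt0 : 0 < u by rewrite lt_neqAle eq_sym u0/=; lra.
case: hz => [hz|ut].
  exists ((t / u) *: a + (1 - t / u) *: z); last first.
    rewrite scalerDr !scalerA mulrCA divff// mulr1 addrC; congr (_ + _ *: _).
    by rewrite mulrBr mulr1 mulrCA divff// mulr1.
  left; apply: convex_hull_conv => //.
  by rewrite divr_ge0 ?(ltW ugt0)// ler_pdivrMr// mul1r; lra.
by exists a; [left|rewrite ut scale0r add0r; congr (_ *: _); lra].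
Qed.


(** * Symmetric polygons as intersections of strips *)

Definition strips m (f : 'I_m -> 'cV[R]_2) : set V :=
  [set x | forall k, `|ev x (f k)| <= 1].

(** By symmetry each inequality [0 <= ev x (g F) + c F] also holds at [- x], hence bounds
    [|ev x (g F)|] by [c F]; dividing by [c F] gives a strip. *)
Lemma symmetric_hull_strips s :
  (forall x, convex_hull s x -> convex_hull s (- x)) ->
  (forall v, exists2 e : R, 0 < e & convex_hull s (e *: v)) ->
  exists m (f : 'I_m -> 'cV[R]_2), convex_hull s = strips f.
Proof.
move=> symD absD.
have [L LP] := cone_polyhedral [seq homog y | y <- s].
pose c (F : 'cV[R]_(2 + 1)) := dsubmx F 0 0.
pose g (F : 'cV[R]_(2 + 1)) := usubmx F.
have evF x F : ev (homog x) F = ev x (g F) + c F.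
  rewrite /ev /homog -[F in LHS]vsubmxK mul_row_col mul1mx.
  by rewrite mxE /c /g.
have DP x : convex_hull s x <-> {in L, forall F, 0 <= ev x (g F) + c F}.
  split=> [/convex_hull_coneP/LP h F /h|h]; first by rewrite evF.
  by apply/convex_hull_coneP/LP => F /h; rewrite evF.
have absev x F : F \in L -> convex_hull s x -> `|ev x (g F)| <= c F.
  move=> FL Dx; have /DP/(_ F FL) := symD _ Dx; have /DP/(_ F FL) := Dx.
  by rewrite evNl ler_norml => h1 h2; apply/andP; split; lra.
(* A strip of width 0 still contains a positive multiple of every vector, so its functional is
   zero. *)
have cF0 F : F \in L -> c F = 0 -> forall v, ev v (g F) = 0.
  move=> FL c0 v; have [e e0 /(absev _ _ FL)] := absD v.
  by rewrite c0 normr_le0 evZl mulf_eq0 gt_eqF//= => /eqP.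
(* As [0^-1 = 0], a degenerate inequality becomes the trivial strip of the zero functional. *)
exists (size L), (fun k => (c (nth 0 L k))^-1 *: g (nth 0 L k)).
apply/seteqP; split=> x Dx.
  move=> k; have FL : nth 0 L k \in L by rewrite mem_nth.
  have := absev _ _ FL Dx; set F := nth 0 L k => h.
  rewrite evZr normrM normfV.
  have cge : 0 <= c F by apply: le_trans h.
  have [c0|c0] := eqVneq (c F) 0; first by rewrite c0 normr0 invr0 mul0r ler01.
  rewrite (ger0_norm cge) mulrC ler_pdivrMr ?mul1r//.
  by rewrite lt_neqAle eq_sym c0.
apply/DP => F FL; have [e _ /(absev _ _ FL)h] := absD 0.
have cge : 0 <= c F by apply: le_trans h.
have [c0|c0] := eqVneq (c F) 0; first by rewrite c0 cF0// addr0.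
have cgt : 0 < c F by rewrite lt_neqAle eq_sym c0.
have lt_i : (index F L < size L)%N by rewrite index_mem.
have := Dx (Ordinal lt_i); rewrite /= nth_index// evZr normrM normfV.
rewrite (gtr0_norm cgt) mulrC ler_pdivrMr// mul1r ler_norml.
by move=> /andP[]; lra.
Qed.

(** Redundant strips are dropped as long as there are any. Then each strip [i] is violated by a
    point [w i] of all the others; scaling it back onto [ev x (f i) = 1] makes the other
    inequalities strict. *)
Lemma irredundant_strips m (f : 'I_m -> 'cV[R]_2) :
  exists m' (g : 'I_m' -> 'cV[R]_2) (z : 'I_m' -> V),
    [/\ strips g = strips f, forall i, ev (z i) (g i) = 1 &
        forall i j, i != j -> `|ev (z i) (g j)| < 1].
Proof.
elim: m f => [|m IH] f; first by exists 0, f, (fun=> 0); split=> // -[].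
have [[i fi]|nred] := pselect (exists i, strips (f \o lift i) = strips f).
  by have [m' [g [z [gf z1 zg]]]] := IH (f \o lift i); exists m', g, z; rewrite gf.
have /choice[w wP] i : exists w : V,
    1 < `|ev w (f i)| /\ forall j, i != j -> `|ev w (f j)| <= 1.
  apply: contrapT => nw; apply: nred; exists i; apply/seteqP.
  split=> x xf k; last exact: xf.
  have [j ->|->] := unliftP i k; first exact: xf.
  rewrite leNgt; apply/negP => lt1; apply: nw; exists x; split=> // j.
  by have [j' -> _|->] := unliftP i j; [exact: xf|rewrite eqxx].
exists m.+1, f, (fun i => (ev (w i) (f i))^-1 *: w i).
have w0 i : 0 < `|ev (w i) (f i)| by apply: le_lt_trans (wP i).1.
split=> // [i|i j neq]; rewrite evZl.
  by rewrite mulVf// -normr_gt0.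
rewrite normrM normfV mulrC ltr_pdivrMr// mul1r.
by apply: le_lt_trans (wP i).1; apply: (wP i).2.
Qed.


(** * Difference sets and parallelograms *)

Definition difference_set A : set V := [set p - q | p in A & q in A].

(** This makes the difference set a hull itself, so that its strip description and its boundedness
    follow from the results on hulls. *)
Lemma difference_set_convex_hull s :
  difference_set (convex_hull s) = convex_hull [seq p - q | p <- s, q <- s].
Proof.
apply/seteqP; split=> [_ [p ps [q qs <-]]|].
  move: p ps q qs; apply: convex_hull_sub => [p p' t t01 hp hp' q qs|p ps].
    suff -> : t *: p + (1 - t) *: p' - q = t *: (p - q) + (1 - t) *: (p' - q).
      by apply: convex_hull_conv => //; [exact: hp|exact: hp'].
    by apply/rowP => i; rewrite !mxE; ring.
  apply: convex_hull_sub => [q q' t t01 hq hq'|q qs].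
    suff -> : p - (t *: q + (1 - t) *: q') = t *: (p - q) + (1 - t) *: (p - q').
      exact: convex_hull_conv.
    by apply/rowP => i; rewrite !mxE; ring.
  by apply: mem_convex_hull; apply/allpairsP; exists (p, q).
apply: convex_hull_sub => [_ _ t t01 [p ps [q qs <-]] [p' ps' [q' qs' <-]]|].
  exists (t *: p + (1 - t) *: p'); first exact: convex_hull_conv.
  exists (t *: q + (1 - t) *: q'); first exact: convex_hull_conv.
  by apply/rowP => i; rewrite !mxE; ring.
move=> x /allpairsP[[p q] /= [ps qs ->]].
by exists p; [|exists q]; rewrite //; exact: mem_convex_hull.
Qed.

Lemma convex_hull_bounded s : exists M : R, forall x, convex_hull s x -> `|x| <= M.
Proof.
have [M _ MP] := seq_max [seq `|x| | x <- s]; exists M.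
apply: convex_hull_sub => [x y t /andP[t0 t1] xM yM|x xs].
  apply: le_trans (ler_normD _ _) _; rewrite !normrZ ger0_norm// ger0_norm ?subr_ge0//.
  have : 0 <= 1 - t by rewrite subr_ge0.
  by nra.
by apply: MP; rewrite inE map_f ?orbT.
Qed.

(** In the coordinates [g] and [h] the difference set is the square [[-1, 1]^2]. Its corners
    [(1, 1)] and [(1, -1)] are differences of points of the hull, and these four points turn out to
    be the corners of a unit box containing the hull. *)
Lemma parallelogram_of_two_strips s (g h : 'cV[R]_2) :
  difference_set (convex_hull s) =
    [set x | `|ev x g| <= 1 /\ `|ev x h| <= 1] ->
  is_parallelogram (convex_hull s).
Proof.
move=> DE; pose A : 'M[R]_2 := \matrix_(i, j) (if j == 0 then g i 0 else h i 0).
have DP x : difference_set (convex_hull s) x <-> `|ev x g| <= 1 /\ `|ev x h| <= 1.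
  by rewrite DE.
have Ag x : (x *m A) 0 0 = ev x g.
  by rewrite /ev !mxE; apply: eq_bigr => i _; rewrite !mxE.
have Ah x : (x *m A) 0 1 = ev x h.
  by rewrite /ev !mxE; apply: eq_bigr => i _; rewrite !mxE.
(* A nonzero vector killed by both functionals would put a whole line into the bounded difference
   set. *)
have Aunit : A \in unitmx.
  rewrite unitmxE unitfE; apply/det0P => -[v v0 vA].
  have [vg vh] : ev v g = 0 /\ ev v h = 0 by rewrite -Ag -Ah vA !mxE.
  have [M MP] := convex_hull_bounded [seq p - q | p <- s, q <- s].
  have := MP ((`|M| + 1) / `|v| *: v); rewrite -difference_set_convex_hull.
  rewrite DP !evZl vg vh !mulr0 normr0 ler01 => /(_ (conj isT isT)).
  rewrite normrZ normrM normfV normr_id divfK ?normr_eq0// ger0_norm ?addr_ge0//.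
  by have := ler_norm M; lra.
have evinj x y : ev x g = ev y g -> ev x h = ev y h -> x = y.
  move=> xyg xyh; apply: (can_inj (mulmxK Aunit)).
  apply/rowP => j; have [->|->] : j = 0 \/ j = 1; [|by rewrite !Ag|by rewrite !Ah].
  by case: j => -[|[|//]] lt_j; [left|right]; apply: val_inj.
have evsurj a b : exists x, ev x g = a /\ ev x h = b.
  exists ((\row_j (if j == 0 then a else b)) *m invmx A).
  by rewrite -Ag -Ah mulmxKV// !mxE.
have [u [ug uh]] := evsurj 1 0; have [v [vg vh]] := evsurj 0 1.
have [p Pp [q Pq pq]] : difference_set (convex_hull s) (u + v).
  by apply/DP; rewrite !evDl ug uh vg vh addr0 add0r normr1.
have [p' Pp' [q' Pq' pq']] : difference_set (convex_hull s) (u - v).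
  by apply/DP; rewrite !evBl ug uh vg vh subr0 sub0r normrN normr1.
have sub_bound x y : convex_hull s x -> convex_hull s y ->
    ev x g - ev y g <= 1 /\ ev x h - ev y h <= 1.
  move=> Px Py; have /DP : difference_set (convex_hull s) (x - y).
    by exists x => //; exists y.
  by rewrite !evBl !ler_norml => -[/andP[_ ?] /andP[_ ?]].
have pqg : ev p g - ev q g = 1 by rewrite -evBl pq evDl ug vg addr0.
have pqh : ev p h - ev q h = 1 by rewrite -evBl pq evDl uh vh add0r.
have pqg' : ev p' g - ev q' g = 1 by rewrite -evBl pq' evBl ug vg subr0.
have pqh' : ev p' h - ev q' h = -1 by rewrite -evBl pq' evBl uh vh sub0r.
(* Since [p - q] attains the maximal width 1 in both coordinates, [q] is the lower left and [p] the
   upper right corner of a box around the hull. *)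
have box r : convex_hull s r ->
    [/\ ev q g <= ev r g, ev r g <= ev q g + 1, ev q h <= ev r h &
        ev r h <= ev q h + 1].
  move=> Pr; have [? ?] := sub_bound r q Pr Pq.
  by have [? ?] := sub_bound p r Pp Pr; split; lra.
have [p'1 p'2 p'3 p'4] := box p' Pp'; have [q'1 q'2 q'3 q'4] := box q' Pq'.
(* Likewise [p' - q' = u - v] forces [p'] and [q'] into the other two corners. *)
have p'E : p' = q + u by apply: evinj; rewrite evDl ?ug ?uh; lra.
have q'E : q' = q + v by apply: evinj; rewrite evDl ?vg ?vh; lra.
have pE : p = q + u + v by apply: evinj; rewrite !evDl ?ug ?uh ?vg ?vh; lra.
exists q, u, v; split.
  rewrite free_cons seq1_free span_seq1; apply/andP; split.
    apply/vlineP => -[k uk]; have := ug; rewrite uk evZl vg mulr0 => /eqP.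
    by rewrite eq_sym oner_eq0.
  by apply/eqP => v0; have := vh; rewrite v0 /ev mul0mx mxE => /eqP;
    rewrite eq_sym oner_eq0.
apply/seteqP; split=> [r Pr|]; last first.
  apply: convex_hull_sub => [x y t|x]; first exact: convex_hull_conv.
  by rewrite !inE => /or4P[] /eqP ->; rewrite -?pE -?p'E -?q'E.
have [r1 r2 r3 r4] := box r Pr.
set a := ev r g - ev q g; set b := ev r h - ev q h.
(* Bilinear interpolation between the four corners. *)
have -> : r = b *: (a *: (q + u + v) + (1 - a) *: (q + v)) +
              (1 - b) *: (a *: (q + u) + (1 - a) *: q).
  by apply: evinj; rewrite !(evDl, evZl) ?ug ?uh ?vg ?vh /a /b; ring.
by do !apply: convex_hull_conv; rewrite ?/a ?/b;
  try (by apply: mem_convex_hull; rewrite !inE eqxx ?orbT);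
  apply/andP; split; lra.
Qed.

(** The zero functional, whose strip is the whole plane, stands in for missing strips. *)
Lemma strips_le2 m (f : 'I_m -> 'cV[R]_2) : (m <= 2)%N ->
  exists g h, strips f = [set x | `|ev x g| <= 1 /\ `|ev x h| <= 1].
Proof.
have ev0 x : `|ev x 0| <= 1 by rewrite /ev mulmx0 mxE normr0 ler01.
case: m f => [|[|[|//]]] f _.
- by exists 0, 0; apply/seteqP; split=> x // _ [].
- exists (f ord0), 0; apply/seteqP; split=> x; first by move=> xf; split.
  by move=> [x0 _] k; rewrite ord1.
- exists (f ord0), (f ord_max); apply/seteqP; split=> x; first by move=> xf; split.
  move=> [x0 x1] k; case: (unliftP ord0 k) => [j|] -> //.
  by rewrite (_ : lift _ _ = ord_max)//; apply: val_inj; rewrite ord1.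
Qed.

(** Besides bounding [d], the clauses in turn decide adjacency within a direction, force adjacency
    across directions, and keep the translates distinct. *)
Lemma three_directions m (f : 'I_m -> 'cV[R]_2) (z : 'I_m -> V) :
  (2 < m)%N -> (forall i, ev (z i) (f i) = 1) ->
  (forall i j, i != j -> `|ev (z i) (f j)| < 1) ->
  exists (d : R) (y : 'I_3 -> V), [/\ 0 < d < 2^-1,
    forall i t, strips f (t *: y i) <-> `|t| <= 1,
    forall i j a b, i != j -> `|a| <= 2^-1 + d -> `|b| <= 2^-1 + d ->
      strips f (a *: y i + b *: y j) &
    forall i j a b, i != j -> a *: y i = b *: y j -> a = 0].
Proof.
move=> m3 z1 zlt.
pose F (p : 'I_m * 'I_m) := `|ev (z p.1) (f p.2)|.
have [r [r0 r1 rP]] : exists r, [/\ 0 <= r, r < 1 & forall i j, i != j ->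
    `|ev (z i) (f j)| <= r].
  exists (\big[Num.max/0]_(p : 'I_m * 'I_m | p.1 != p.2) F p); split.
  - exact: bigmax_ge_id.
  - by apply/bigmax_ltP; split=> // -[i j] /= /zlt.
  - by move=> i j neq; apply: (@le_bigmax_cond _ _ _ _ (i, j) (fun p => p.1 != p.2) F).
pose w := widen_ord m3; have wneq i j : i != j -> w i != w j by [].
(* Each functional has absolute value 1 at no more than one of two chosen points and at most [r] at
   the other, so the two values sum to at most [1 + r]; this [d] gives
   [(1/2 + d) (1 + r) = 1 - (1 - r)^2 / 4]. *)
exists ((1 - r) / 4), (z \o w); split=> /=.
- by apply/andP; split; lra.
- move=> i t; split=> [/(_ (w i))|t1 k]; first by rewrite evZl z1 mulr1.
  rewrite evZl normrM mulr_ile1//.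
  by have [<-|/zlt/ltW//] := eqVneq (w i) k; rewrite z1 normr1.
- move=> i j a b neq ha hb k; rewrite evDl !evZl.
  apply: le_trans (ler_normD _ _) _; rewrite !normrM.
  set s := `|ev (z (w i)) _|; set t := `|ev (z (w j)) _|.
  have st : s + t <= 1 + r.
    rewrite /s /t; have [ik|/rP ir] := eqVneq (w i) k.
      rewrite -ik z1 normr1 lerD2l rP// eq_sym; exact: wneq.
    rewrite addrC lerD//; have [<-|/rP jr] := eqVneq (w j) k; first by rewrite z1 normr1.
    by rewrite (le_trans jr)// ltW.
  have s0 : 0 <= s by exact: normr_ge0.
  have t0 : 0 <= t by exact: normr_ge0.
  have := ler_wpM2r s0 ha; have := ler_wpM2r t0 hb.
  have : (2^-1 + (1 - r) / 4) * (s + t) <= (2^-1 + (1 - r) / 4) * (1 + r).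
    by rewrite ler_wpM2l//; lra.
  by have := sqr_ge0 (1 - r); nra.
- move=> i j a b neq ab; apply/eqP; apply: contraT => a0.
  have a_gt0 : 0 < `|a| by rewrite normr_gt0.
  (* Applying [f (w j)] to the equation gives [|b| < |a|], while [f (w i)] gives [|a| <= |b|]. *)
  have := congr1 (fun x => `|ev x (f (w i))|) ab.
  have := congr1 (fun x => `|ev x (f (w j))|) ab.
  rewrite !evZl !z1 !mulr1 !normrM => eqb eqa.
  have : `|b| < `|a| by rewrite -eqb gtr_pMr// zlt// wneq.
  by rewrite ltNge eqa ler_piMr// ltW// zlt// wneq// eq_sym.
Qed.

(** Otherwise the hull would be mapped into itself by a nonzero translation, hence be unbounded. *)
Lemma translate_inj s v w : convex_hull s !=set0 ->
  [set 1 *: x + v | x in convex_hull s] = [set 1 *: x + w | x in convex_hull s] ->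
  v = w.
Proof.
move=> [x0 Px0] vw; apply/eqP; rewrite -subr_eq0; apply: contraT => d0.
have step x : convex_hull s x -> convex_hull s (x + (v - w)).
  move=> Px; have : [set 1 *: x + v | x in convex_hull s] (1 *: x + v) by exists x.
  rewrite vw => -[y Py]; rewrite !scale1r => yx.
  by rewrite addrA -yx addrK.
have steps k : convex_hull s (x0 + (v - w) *+ k).
  by elim: k => [|k IH]; rewrite ?addr0// mulrSr addrA; exact: step.
have [M MP] := convex_hull_bounded s.
have M0 : 0 <= M by apply: le_trans (MP _ Px0).
have vw0 : 0 < `|v - w| by rewrite normr_gt0.
pose k := Num.bound ((M + M) / `|v - w|).
have kP : (M + M) / `|v - w| < k%:R.
  by apply: archi_boundP; rewrite divr_ge0// addr_ge0.
have := MP _ Px0; have := MP _ (steps k).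
move: kP; rewrite ltr_pdivrMr// => kP h1 h2.
have : `|(v - w) *+ k| <= M + M.
  rewrite -[_ *+ k](addKr x0) addrC; apply: le_trans (ler_normB _ _) _.
  exact: lerD.
by rewrite normrMn -mulr_natl; lra.
Qed.

End Hull.

(** * Joins of three complements of half graphs *)

(* Vertex [6 * k + 3 * b + i] is the translate of level [k], on the positive
   ([b = false]) or negative ([b = true]) side, in direction [i]. *)
Definition dir (v : nat) : 'I_3 := inord (v %% 3).
Definition side (v : nat) : bool := odd (v %/ 3).
Definition level (v : nat) : nat := v %/ 6.
Definition vert (i : 'I_3) (b : bool) (k : nat) : nat := 6 * k + 3 * b + i.

Lemma dir_vert i b k : dir (vert i b k) = i.
Proof.
apply: val_inj; rewrite /dir /= inordK ?ltn_pmod// /vert.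
by have := ltn_ord i; lia.
Qed.

Lemma side_vert i b k : side (vert i b k) = b.
Proof.
rewrite /side /vert; have i3 := ltn_ord i.
have -> : ((6 * k + 3 * b + i) %/ 3 = k.*2 + b)%N by case: b; lia.
by rewrite oddD odd_double; case: b.
Qed.

Lemma level_vert i b k : level (vert i b k) = k.
Proof. by rewrite /level /vert; have := ltn_ord i; case: b => /=; lia. Qed.

(** These pairs are the non-edges, oriented from the positive to the negative side; they form a half
    graph in each direction. *)
Definition conflict (v w : nat) : bool :=
  [&& dir v == dir w, ~~ side v, side w & level w < level v]%N.

(** A threshold in each direction selects the positive vertices up to it and the negative vertices
    from it on. Only the [n %/ 6] complete levels serve as thresholds, so that the threshold
    vertices exist on both sides. *)
Lemma num_maximal_cliques_half_graphs (n : nat) (G : 'M[bool]_n) :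
  (forall v w, G v w = [&& v != w, ~~ conflict v w & ~~ conflict w v]) ->
  ((n %/ 6) ^ 3 <= num_maximal_cliques G)%N.
Proof.
move=> GE; set m := (n %/ 6)%N.
have vertP i b (k : 'I_m) : exists v : 'I_n,
    [/\ dir v = i, side v = b & level v = k].
  have lt_vn : (vert i b k < n)%N.
    by rewrite /vert; have := ltn_ord i; have := ltn_ord k; rewrite /m; case: b; lia.
  by exists (Ordinal lt_vn); rewrite dir_vert side_vert level_vert.
pose K (t : {ffun 'I_3 -> 'I_m}) := [set v : 'I_n |
  if side v then (t (dir v) <= level v)%N else (level v <= t (dir v))%N]%SET.
have Kconf t v w : v \in K t -> w \in K t -> ~~ conflict v w.
  rewrite !inE => vK wK; apply/negP => /and4P[/eqP dvw sv sw lt_wv].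
  move: vK wK; rewrite (negbTE sv) sw dvw => le1 le2.
  by move: (leq_ltn_trans le2 (leq_trans lt_wv le1)); rewrite ltnn.
have Kinj : injective K.
  suff le_t t t' i : K t = K t' -> (t i <= t' i)%N.
    move=> t t' eqK; apply/ffunP => i; apply: val_inj; apply/eqP.
    by rewrite eqn_leq !le_t.
  (* The positive vertex at the threshold of [t] lies in [K t'] only if [t i <= t' i]. *)
  move=> eqK; have [v [dv sv lv]] := vertP i false (t i).
  have : v \in K t by rewrite inE sv dv lv.
  by rewrite eqK inE sv dv lv.
rewrite -[leqLHS](_ : #|K @: [set: {ffun 'I_3 -> 'I_m}]%SET| = _); last first.
  by rewrite card_imset // cardsT card_ffun !card_ord.
apply: subset_leq_card; apply/fintype.subsetP => _ /imsetP[t _ ->].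
rewrite inE; apply/maxsetP; split.
  apply/forall_inP => v vK; apply/forall_inP => w wK; apply/implyP => neq_vw.
  by rewrite GE neq_vw !(Kconf t).
move=> B /forall_inP clB sKB; apply/eqP; rewrite finset.eqEsubset sKB andbT.
apply/fintype.subsetP => v vB; apply: contraT => vNK.
(* A vertex outside [K t] conflicts with the threshold vertex on the opposite side, which lies in
   [K t]. *)
have [w [dw sw lw]] := vertP (dir v) (~~ side v) (t (dir v)).
have wB : w \in B.
  by apply: (fintype.subsetP sKB); rewrite inE sw dw lw; case: (side v) => /=.
have neq_vw : v != w.
  by apply: contra_eqN sw => /eqP ->; case: (side w).
have := forall_inP (clB v vB) w wB; rewrite neq_vw GE /= neq_vw /=.
rewrite /conflict dw sw lw eqxx /=; move: vNK; rewrite inE.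
by case: (side v); rewrite -ltnNge => ->.
Qed.

(** * Realization by translates of the polygon *)

Section Construction.
Context {R : realType}.
Local Notation V := 'rV[R]_2.
Implicit Types (s : seq V) (y : 'I_3 -> V) (d : R).

(** For [v] positive and [w] negative the offsets differ by [1 + d (level v - level w) / n], which
    exceeds 1 exactly when the levels conflict; dividing by [n] keeps all shifts between 0 and
    [d]. *)
Definition offset d (n v : nat) : R :=
  (if side v then - 2^-1 else 2^-1) + d * (level v)%:R / n%:R.

Lemma vert_coord v : v = vert (dir v) (side v) (level v).
Proof.
by rewrite /vert /dir /side /level inordK ?ltn_pmod// -modn2; lia.
Qed.

Lemma level_bound d (n v : nat) : 0 < d -> (v < n)%N ->
  0 <= d * (level v)%:R / n%:R <= d.
Proof.
move=> d0 vn; have n0 : 0 < n%:R :> R by rewrite ltr0n; lia.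
rewrite divr_ge0 ?mulr_ge0 ?(ltW d0)//= ler_pdivrMr// ler_wpM2l ?(ltW d0)//.
by rewrite ler_nat /level; lia.
Qed.

Lemma abs_offset d (n v : nat) : 0 < d < 2^-1 -> (v < n)%N ->
  `|offset d n v| <= 2^-1 + d.
Proof.
move=> /andP[d0 d1] vn; have /andP[h0 h1] := level_bound d0 vn.
by rewrite ler_norml /offset; case: ifP => _; apply/andP; split; lra.
Qed.

Lemma offset_neq0 d (n v : nat) : 0 < d < 2^-1 -> (v < n)%N -> offset d n v != 0.
Proof.
move=> /andP[d0 d1] vn; have /andP[h0 h1] := level_bound d0 vn.
by rewrite /offset; case: ifP => _; apply/eqP => h; lra.
Qed.

Lemma offset_inj d (n v w : nat) : 0 < d < 2^-1 -> (v < n)%N -> (w < n)%N ->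
  offset d n v = offset d n w -> side v = side w /\ level v = level w.
Proof.
move=> /andP[d0 d1] vn wn.
have /andP[v0 v1] := level_bound d0 vn; have /andP[w0 w1] := level_bound d0 wn.
have n0 : n%:R != 0 :> R by rewrite pnatr_eq0; lia.
have levelE : d * (level v)%:R / n%:R = d * (level w)%:R / n%:R -> level v = level w.
  move/(divIf n0)/(mulfI (lt0r_neq0 d0))/eqP.
  by rewrite eqr_nat => /eqP.
rewrite /offset; case: (side v); case: (side w) => h; last 1 first.
- by split=> //; apply: levelE; lra.
- by split=> //; apply: levelE; lra.
- by exfalso; lra.
- by exfalso; lra.
Qed.

Lemma offset_conflict d (n v w : nat) : 0 < d < 2^-1 -> (v < n)%N -> (w < n)%N ->
  dir v = dir w ->
  (`|offset d n v - offset d n w| <= 1) = ~~ conflict v w && ~~ conflict w v.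
Proof.
move=> /andP[d0 d1] vn wn dvw.
have /andP[v0 v1] := level_bound d0 vn; have /andP[w0 w1] := level_bound d0 wn.
have n0 : 0 < n%:R :> R by rewrite ltr0n; lia.
have levelE (a b : nat) : (d * a%:R / n%:R <= d * b%:R / n%:R) = (a <= b)%N.
  by rewrite ler_pM2r ?invr_gt0// ler_pM2l// ler_nat.
rewrite /conflict dvw eqxx /= /offset.
case: (side v); case: (side w) => /=; rewrite ?andbT -?leqNgt -?levelE.
- by rewrite ler_norml; apply/andP; split; lra.
- rewrite ler_norml; apply/andP/idP => [[]|]; first lra.
  by move=> ?; split; lra.
- rewrite ler_norml; apply/andP/idP => [[]|]; first lra.
  by move=> ?; split; lra.
- by rewrite ler_norml; apply/andP; split; lra.
Qed.

Lemma exists_translates_graph s d y n :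
  convex_hull s !=set0 -> 0 < d < 2^-1 ->
  (forall i t, difference_set (convex_hull s) (t *: y i) <-> `|t| <= 1) ->
  (forall i j a b, i != j -> `|a| <= 2^-1 + d -> `|b| <= 2^-1 + d ->
     difference_set (convex_hull s) (a *: y i + b *: y j)) ->
  (forall i j a b, i != j -> a *: y i = b *: y j -> a = 0) ->
  exists2 G : 'M[bool]_n, in_Phom (convex_hull s) G &
    forall v w, G v w = [&& v != w, ~~ conflict v w & ~~ conflict w v].
Proof.
move=> P0 d01 same diff indep; set P := convex_hull s.
pose p (v : 'I_n) : V := offset d n v *: y (dir v).
pose F v := [set 1 *: x + p v | x in P].
pose G : 'M[bool]_n := \matrix_(v, w) [&& v != w, ~~ conflict v w & ~~ conflict w v].
(* If [y i] were 0, then [2 *: y i] would lie in the difference set, contradicting [same] at 2. *)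
have y_neq0 i : y i != 0.
  apply/eqP => yi0; have /same : difference_set P (2 *: y i).
    have /same : `|0 : R| <= 1 by rewrite normr0.
    by move=> /(_ i); rewrite yi0 !scaler0.
  by rewrite ger0_norm//; lra.
exists G => [|v w]; last by rewrite mxE.
exists F; split.
(* Across directions [indep] would make an offset zero; within one, the offset determines side and
   level, hence the vertex. *)
- move=> v w /(translate_inj P0); rewrite /p => pvw.
  have [dvw|dvw] := eqVneq (dir v) (dir w); last first.
    by have /eqP := indep _ _ _ _ dvw pvw; rewrite (negbTE (offset_neq0 _ _)).
  move: pvw; rewrite dvw => /eqP; rewrite -subr_eq0 -scalerBl scaler_eq0.
  rewrite (negbTE (y_neq0 _)) orbF subr_eq0 => /eqP /offset_inj[]// svw lvw.
  by apply: val_inj; rewrite /= (vert_coord v) (vert_coord w) dvw svw lvw.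
- by move=> v; exists 1, (p v).
move=> v w.
have FI : F v `&` F w !=set0 <-> difference_set P (p w - p v).
  rewrite /F; split=> [[_ [[x Px <-] [x' Px' /eqP]]]|[x Px [x' Px' xx']]].
    rewrite !scale1r => /eqP xx'; exists x => //; exists x' => //.
    by apply/eqP; rewrite subr_eq addrAC eq_sym subr_eq addrC -xx' addrC.
  exists (x + p v); split; first by exists x; rewrite ?scale1r.
  exists x' => //; rewrite scale1r.
  by rewrite -[p w](subrK (p v)) -xx' addrA [x' + _]addrC subrK.
rewrite mxE; have [->|neq_vw] /= := eqVneq v w; first by split=> // -[].
split=> [nc|[_ /FI]].
  split=> //; apply/FI; rewrite /p.
  have [dvw|dvw] := eqVneq (dir w) (dir v).
    by rewrite dvw -scalerBl; apply/same; rewrite offset_conflict// andbC.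
  by rewrite -scaleNr; apply: diff; rewrite ?normrN ?abs_offset.
have [dvw|dvw] := eqVneq (dir w) (dir v).
  by rewrite /p dvw -scalerBl => /same; rewrite offset_conflict// andbC.
by rewrite /conflict (negbTE dvw) eq_sym (negbTE dvw).
Qed.

Lemma polygon_num_maximal_cliques (P : set V) (n : nat) :
  is_polygon P -> ~ is_parallelogram P ->
  ((n %/ 6) ^ 3 <= max_num_maximal_cliques P n)%N.
Proof.
move=> [[s ->] [x0 Px0]] nP; set P0 := convex_hull s.
have P0x0 : P0 x0 by apply: interior_subset.
have symD x : difference_set P0 x -> difference_set P0 (- x).
  by move=> [p Pp [q Pq <-]]; rewrite opprB; exists q => //; exists p.
have absD v : exists2 e : R, 0 < e & difference_set P0 (e *: v).
  (* Since [x0] is interior, a small move from it along [v] stays in the polygon; subtracting [x0]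
     leaves a positive multiple of [v]. *)
  have : \forall e \near (0 : R), P0 (x0 + e *: v).
    have cv : (fun e : R => x0 + e *: v) @ (0 : R) --> x0.
      have -> : nbhs x0 = nbhs (x0 + (0 : R) *: v) by rewrite scale0r addr0.
      by apply: cvgD; [|apply: cvgZ]; [exact: cvg_cst|exact: cvg_id|exact: cvg_cst].
    exact: cv.
  move=> /nbhs_ballP[e /= e0 eP]; exists (e / 2); first by rewrite divr_gt0.
  exists (x0 + (e / 2) *: v); last by exists x0; rewrite // addrC addKr.
  apply: eP; rewrite /ball /= sub0r normrN gtr0_norm ?divr_gt0//.
  by rewrite ltr_pdivrMr// ltr_pMr// ltr1n.
rewrite /P0 difference_set_convex_hull in symD absD.
have [m [f fD]] := symmetric_hull_strips symD absD.
have [m' [g [z [gf z1 zlt]]]] := irredundant_strips f.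
have DE : difference_set P0 = strips g by rewrite gf -fD difference_set_convex_hull.
have [m2|m3] := leqP m' 2.
  by have [a [b abE]] := strips_le2 g m2; case: nP;
    apply: (@parallelogram_of_two_strips _ s a b); rewrite -abE.
have [d [y [d01 same diff indep]]] := three_directions m3 z1 zlt.
rewrite -DE in same diff.
have P0n0 : P0 !=set0 by exists x0.
have [G GP GE] := exists_translates_graph n P0n0 d01 same diff indep.
apply: leq_trans (num_maximal_cliques_half_graphs GE) _.
by apply: (@leq_bigmax_cond _ _ (@num_maximal_cliques n)); apply/asboolP.
Qed.

End Construction.

Theorem theorem7 (R : realType) (P : set 'rV[R]_2)
  (hP : is_polygon P) (hnp : ~ is_parallelogram P) :
  (fun n : nat => (max_num_maximal_cliques P n)%:R : R)
    =Omega_\oo (fun n : nat => n%:R ^+ 3).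
Proof.
(* For [n >= 6], rounding [n / 6] down loses at most half of it, so [n %/ 6] is at least
   [n / 12]. *)
rewrite eqOmegaE; apply/asboolP; exists (12^-1 ^+ 3);
  first by rewrite exprn_gt0// invr_gt0.
exists 6%N => // n /= n6.
rewrite !ger0_norm ?exprn_ge0// -exprMn.
apply: le_trans (_ : ((n %/ 6) ^ 3)%N%:R <= _); last first.
  by rewrite ler_nat polygon_num_maximal_cliques.
rewrite natrX lerXn2r ?nnegrE ?mulr_ge0 ?invr_ge0//.
by rewrite mulrC ler_pdivrMr// -natrM ler_nat; lia.
Qed.
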